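(* Suppose $K$ is an entropy estimator for $\mathcal{C}$, and let $\rho\in\mathcal{C}$. Then the asymptotic gain rate at $\rho$ of $\mathcal{C}$ is at least the entropy estimate of $K$ at $\rho$, given by $\sigma=\mathbb{E}_\rho(K(CZ))$.
   Context: $C,Z$ are random variables with finite value spaces and $D$ is a function of $C$. $\mathcal{C}$ is a set of distributions of $CZ$. $\nu(D|Z)$ is the random variable whose value at $cz$ is $\nu(d|z)$, $d=D(c)$. Expectations are sums over values of positive probability only; $\log$ is natural with $\log0=-\infty$. Entropy estimator: a real-valued function $K$ of $CZ$ such that $\mathbb{E}_\nu(K(CZ))\le\mathbb{E}_\nu(-\log(\nu(D|Z)))$ for all $\nu\in\mathcal{C}$. PEF: a probability estimation factor with power $\beta>0$ for $\mathcal{C}$ (and $D|Z$) is a non-negative function $F=F(CZ)$ such that $\mathbb{E}_\nu(F(CZ)\,\nu(D|Z)^\beta)\le1$ for all $\nu\in\mathcal{C}$. Its log-prob rate at $\rho$ is $\mathbb{E}_\rho(\log F(CZ))/\beta$. The asymptotic gain rate at $\rho$ of $\mathcal{C}$ is the supremum of the log-prob rates at $\rho$ achievable by PEFs with positive power for $\mathcal{C}$ (over all $\beta>0$ and all PEFs with power $\beta$). *)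

(* Defs.v *)
From HB Require Import structures.
From mathcomp Require Import all_boot all_order all_algebra.
From mathcomp Require Import all_classical all_reals all_analysis.

Set Implicit Arguments.
Unset Strict Implicit.
Unset Printing Implicit Defensive.

Import Order.TTheory GRing.Theory Num.Theory.

Local Open Scope classical_set_scope.
Local Open Scope ring_scope.

Record fdist (R : realType) (T : finType) := FDist {
  pmf :> {ffun T -> R};
  pmf_ge0 : forall x, 0 <= pmf x;
  pmf_sum1 : \sum_x pmf x = 1 }.

(* The sum runs over the values of positive probability only, and X may take
   infinite values (logarithms of 0). *)
Definition expect (R : realType) (T : finType) (nu : fdist R T)
    (X : T -> \bar R) : \bar R :=
  (\sum_(x | (0 < nu x)%R) (nu x)%:E * X x)%E.

(* nu(D|Z) as a random variable: its value at (c, z) is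
   nu(D = D c, Z = z) / nu(Z = z).  If nu(Z = z) = 0 the quotient is 0, but then
   (c, z) has probability 0 and does not contribute to expectations. *)
Definition cond_prob (R : realType) (C Z TD : finType) (D : C -> TD)
    (nu : fdist R (C * Z)%type) (cz : C * Z) : R :=
  (\sum_(x | (D x.1 == D cz.1) && (x.2 == cz.2)) nu x) /
  (\sum_(x | x.2 == cz.2) nu x).

(* lne is the natural logarithm with lne 0 = -oo. *)
Definition entropy_estimator (R : realType) (C Z TD : finType) (D : C -> TD)
    (M : set (fdist R (C * Z)%type)) (K : C * Z -> R) : Prop :=
  forall nu, M nu ->
    (expect nu (fun cz => (K cz)%:E) <=
     expect nu (fun cz => - lne (cond_prob D nu cz)%:E))%E.

Definition is_PEF (R : realType) (C Z TD : finType) (D : C -> TD)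
    (M : set (fdist R (C * Z)%type)) (beta : R) (F : C * Z -> R) : Prop :=
  [/\ 0 < beta,
      forall cz, 0 <= F cz &
      forall nu, M nu ->
        (expect nu (fun cz => (F cz * cond_prob D nu cz `^ beta)%:E) <= 1)%E].

Definition log_prob_rate (R : realType) (C Z : finType)
    (rho : fdist R (C * Z)%type) (beta : R) (F : C * Z -> R) : \bar R :=
  (expect rho (fun cz => lne (F cz)%:E) * (beta^-1)%:E)%E.

Definition asymptotic_gain_rate (R : realType) (C Z TD : finType) (D : C -> TD)
    (M : set (fdist R (C * Z)%type)) (rho : fdist R (C * Z)%type) : \bar R :=
  ereal_sup [set r | exists (beta : R) (F : C * Z -> R),
    is_PEF D M beta F /\ r = log_prob_rate rho beta F].

(* Main.v *)
Require Import Defs.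
From HB Require Import structures.
From mathcomp Require Import all_boot all_order all_algebra.
From mathcomp Require Import all_classical all_reals all_analysis.
From mathcomp Require Import lra ring.

Set Implicit Arguments.
Unset Strict Implicit.
Unset Printing Implicit Defensive.

Import Order.TTheory GRing.Theory Num.Theory.

Local Open Scope classical_set_scope.
Local Open Scope ring_scope.

(** Put [u = K + log nu(D|Z)]: the estimator hypothesis says that [E_nu u <= 0].
    For small [beta], [beta u] is bounded above and
    [exp (beta u) <= 1 + beta u + 2 beta^2 u^2], where [E_nu u^2 <= B] with [B]
    independent of [nu], because [nu(cz) <= nu(d|z)] and [t (log t)^2] is bounded
    on [(0, 1]].  Hence [F = exp (beta K) / (1 + 2 B beta^2)] is a PEF with power
    [beta]; its log-prob rate is at least [E_rho K - 2 B beta], and [beta] is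
    arbitrarily small. *)

(** Inverting [1 - x <= expR (- x)] gives [expR x <= (1 - x)^-1]; the quadratic times [1 - x] is
    [1 + x ^+ 2 * (1 - 2 * x)], at least 1 because [x <= 2^-1]. *)
Lemma expR_le_quadratic (R : realType) (x : R) :
  x <= 2^-1 -> expR x <= 1 + x + 2 * x ^+ 2.
Proof.
move=> x_le; have x1_gt0 : 0 < 1 - x by lra.
have le_inv : expR x <= (1 - x)^-1.
  rewrite -[x in expR x]opprK expRN lef_pV2 ?posrE ?expR_gt0 //.
  exact: expR_ge1Dx.
apply: (le_trans le_inv); rewrite -[_^-1]mul1r ler_pdivrMr //.
have -> : (1 + x + 2 * x ^+ 2) * (1 - x) = 1 + x ^+ 2 * (1 - 2 * x) by ring.
by rewrite lerDl mulr_ge0 ?sqr_ge0 //; lra.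
Qed.

(** With [s = - ln p >= 0], the quadratic term of the exponential series gives
    [1 + s ^+ 2 / 2 <= expR s = p^-1]. *)
Lemma mul_ln_sqr_le (R : realType) (p : R) :
  0 < p -> p <= 1 -> p * ln p ^+ 2 <= 2.
Proof.
move=> p_gt0 p_le1; have lnN_ge0 : 0 <= - ln p by rewrite oppr_ge0 ln_le0.
have := expR_ge1Dxn 1 lnN_ge0; rewrite expRN lnK ?posrE // sqrrN => le_pV.
rewrite mulrC -ler_pdivlMr //.
have fact2 : (2`!%:R : R) = 2 by [].
by move: le_pV; rewrite fact2; lra.
Qed.

Section FiniteDistributions.
Variables (R : realType) (T : finType) (nu : fdist R T).

Lemma sum_pmf_support : \sum_(x | 0 < nu x) nu x = 1.
Proof.
rewrite -(pmf_sum1 nu) [RHS](bigID (fun x => 0 < nu x)) /= [X in _ + X]big1 ?addr0 //.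
by move=> x; rewrite lt0r Defs.pmf_ge0 andbT negbK => /eqP.
Qed.

Lemma pmf_le_sum (P : pred T) (x : T) : P x -> nu x <= \sum_(y | P y) nu y.
Proof.
by move=> Px; rewrite (bigD1 x) //= lerDl sumr_ge0 // => y _; apply: Defs.pmf_ge0.
Qed.

Lemma sum_pmf_le (P Q : pred T) : (forall x, P x -> Q x) ->
  \sum_(x | P x) nu x <= \sum_(x | Q x) nu x.
Proof.
move=> PQ; rewrite big_mkcond [leRHS]big_mkcond; apply: ler_sum => x _.
case: ifP => [/PQ -> //|_]; case: ifP => // _.
exact: Defs.pmf_ge0.
Qed.

(** Agreement on the support is enough, so [lne] can become the real [ln] wherever its argument is
    positive there. *)
Lemma expect_EFin (X : T -> \bar R) (f : T -> R) :
  (forall x, 0 < nu x -> X x = (f x)%:E) ->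
  expect nu X = (\sum_(x | 0 < nu x) nu x * f x)%:E.
Proof.
move=> Xf; rewrite /expect -sumEFin; apply: eq_bigr => x nux.
by rewrite Xf.
Qed.

End FiniteDistributions.

Section ConditionalProbability.
Variables (R : realType) (C Z TD : finType) (D : C -> TD).
Variables (nu : fdist R (C * Z)%type) (cz : C * Z).
Hypothesis nu_gt0 : 0 < nu cz.

Let marginal_gt0 : 0 < \sum_(x | x.2 == cz.2) nu x.
Proof. by apply: (lt_le_trans nu_gt0); apply: pmf_le_sum. Qed.

Lemma pmf_le_cond_prob : nu cz <= cond_prob D nu cz.
Proof.
rewrite /cond_prob ler_pdivlMr //.
apply: (@le_trans _ _ (nu cz)); last by apply: pmf_le_sum; rewrite !eqxx.
rewrite ler_piMr ?Defs.pmf_ge0 // -(pmf_sum1 nu).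
exact: sum_pmf_le.
Qed.

Lemma cond_prob_gt0 : 0 < cond_prob D nu cz.
Proof. exact: lt_le_trans nu_gt0 pmf_le_cond_prob. Qed.

Lemma cond_prob_le1 : cond_prob D nu cz <= 1.
Proof.
rewrite /cond_prob ler_pdivrMr // mul1r.
by apply: sum_pmf_le => x /andP[].
Qed.

End ConditionalProbability.

Section Estimator.
Variables (R : realType) (C Z TD : finType) (D : C -> TD).
Variables (M : set (fdist R (C * Z)%type)) (K : C * Z -> R).
Hypothesis hK : entropy_estimator D M K.

Let deviation nu cz := K cz + ln (cond_prob D nu cz).

Lemma estimator_deviation_le0 nu : M nu ->
  \sum_(cz | 0 < nu cz) nu cz * deviation nu cz <= 0.
Proof.
move=> /hK; rewrite (@expect_EFin _ _ _ _ K) //.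
rewrite (@expect_EFin _ _ _ _ (fun cz => - ln (cond_prob D nu cz))); last first.
  by move=> cz nu_gt0; rewrite lne_EFin // cond_prob_gt0.
rewrite lee_fin -subr_le0 -sumrB.
under eq_bigr do rewrite -mulrBr opprK.
by [].
Qed.

(** Each summand comes from [(a + b) ^+ 2 <= 2 * a ^+ 2 + 2 * b ^+ 2], with weight at most 1 on
    [K cz ^+ 2] and [p * ln p ^+ 2 <= 2]. Summing over all [cz], not just the support, makes [B]
    independent of [nu]. *)
Let B := \sum_cz (2 * K cz ^+ 2 + 4).

Let B_ge0 : 0 <= B.
Proof. by apply: sumr_ge0 => cz _; have := sqr_ge0 (K cz); lra. Qed.

Lemma estimator_deviation_sqr_le (nu : fdist R (C * Z)%type) :
  \sum_(cz | 0 < nu cz) nu cz * deviation nu cz ^+ 2 <= B.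
Proof.
rewrite /B big_mkcond; apply: ler_sum => cz _; case: ifPn => [nu_gt0|_]; last first.
  by have := sqr_ge0 (K cz); lra.
have p_gt0 := cond_prob_gt0 D nu_gt0.
have le_p := pmf_le_cond_prob D nu_gt0.
have p_le1 := cond_prob_le1 D nu_gt0.
have ln_le := mul_ln_sqr_le p_gt0 p_le1.
rewrite /deviation; set p := cond_prob D nu cz in p_gt0 le_p p_le1 ln_le *.
have nuK : nu cz * K cz ^+ 2 <= K cz ^+ 2.
  by rewrite ler_piMl ?sqr_ge0 // (le_trans le_p).
have nul : nu cz * ln p ^+ 2 <= 2.
  by apply: le_trans ln_le; rewrite ler_wpM2r ?sqr_ge0.
have sq : nu cz * (K cz + ln p) ^+ 2 <= nu cz * (2 * K cz ^+ 2 + 2 * ln p ^+ 2).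
  rewrite ler_wpM2l ?Defs.pmf_ge0 //.
  by have := sqr_ge0 (K cz - ln p); rewrite sqrrB sqrrD; lra.
apply: (le_trans sq); lra.
Qed.

Variable beta : R.
Hypotheses (beta_gt0 : 0 < beta) (betaK : forall cz, beta * K cz <= 2^-1).

Let N := 1 + 2 * B * beta ^+ 2.

Let N_gt0 : 0 < N.
Proof. by rewrite ltr_pwDl // !mulr_ge0 // ltW. Qed.

(** The denominator bounds the expectation of [expR (beta * deviation nu cz)] uniformly over [nu] in
    [M]. *)
Definition estimator_PEF cz := expR (beta * K cz) / (1 + 2 * B * beta ^+ 2).

Lemma is_PEF_estimator_PEF : is_PEF D M beta estimator_PEF.
Proof.
split=> // [cz|nu Mnu].
  by rewrite divr_ge0 ?expR_ge0 // ltW.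
(* On the support the conditional probability is nonzero, so its power is the exponential of [beta]
   times its logarithm and merges with [expR (beta * K cz)]. *)
rewrite (@expect_EFin _ _ _ _ (fun cz => expR (beta * deviation nu cz) / N)); last first.
  move=> cz nu_gt0; rewrite /estimator_PEF /powR gt_eqF ?cond_prob_gt0 //.
  by rewrite mulrAC -expRD -mulrDr.
rewrite lee_fin; under eq_bigr do rewrite mulrA.
rewrite -mulr_suml ler_pdivrMr // mul1r.
have pointwise cz : 0 < nu cz -> nu cz * expR (beta * deviation nu cz) <=
    nu cz + beta * (nu cz * deviation nu cz)
    + 2 * beta ^+ 2 * (nu cz * deviation nu cz ^+ 2).
  move=> nu_gt0.
  (* Only an upper bound is required, and the logarithm of a probability is nonpositive, so [betaK]
     suffices. *)
  have small : beta * deviation nu cz <= 2^-1.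
    apply: le_trans (betaK cz); rewrite ler_pM2l // gerDl.
    by rewrite ln_le0 // cond_prob_le1.
  have := expR_le_quadratic small.
  rewrite -(ler_pM2l nu_gt0) => /le_trans; apply.
  by lra.
apply: (le_trans (ler_sum _ pointwise)).
(* The constant term sums to 1; the linear term is at most 0 and the quadratic one at most
   [2 * B * beta ^+ 2], which totals [N]. *)
rewrite !big_split /= sum_pmf_support -!mulr_sumr /N -addrA lerD2l.
have := estimator_deviation_le0 Mnu; rewrite -(pmulr_rle0 _ beta_gt0) => lin.
have b2 : 0 <= 2 * beta ^+ 2 by rewrite mulr_ge0 ?sqr_ge0.
have quad := ler_wpM2l b2 (estimator_deviation_sqr_le nu).
by apply: (le_trans (lerD lin quad)); lra.
Qed.

(** Normalising costs [ln N / beta] in the rate, and [ln (1 + x) <= x] bounds this by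
    [2 * B * beta]. *)
Lemma log_prob_rate_estimator_PEF (rho : fdist R (C * Z)%type) :
  (expect rho (fun cz => (K cz)%:E) <=
   log_prob_rate rho beta estimator_PEF + (2 * B * beta)%:E)%E.
Proof.
rewrite /log_prob_rate (@expect_EFin _ _ _ _ K) //.
rewrite (@expect_EFin _ _ _ _ (fun cz => beta * K cz - ln N)); last first.
  move=> cz _; rewrite lne_EFin ?divr_gt0 ?expR_gt0 //.
  by rewrite ln_div ?posrE ?expR_gt0 // expRK.
rewrite -EFinM -EFinD lee_fin -lerBlDr ler_pdivlMr //.
under [leRHS]eq_bigr do rewrite mulrBr mulrCA.
rewrite sumrB -mulr_sumr -mulr_suml sum_pmf_support mul1r.
have lnN : ln N <= 2 * B * beta ^+ 2.
  apply: le_ln1Dx; apply: (@lt_le_trans _ _ 0); first by rewrite ltrN10.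
  by rewrite !mulr_ge0 // ltW.
apply: (@le_trans _ _ (beta * (\sum_(i | 0 < rho i) rho i * K i) - 2 * B * beta ^+ 2)).
  by lra.
by rewrite lerD2l lerN2.
Qed.

End Estimator.

Theorem theorem41 (R : realType) (C Z TD : finType) (D : C -> TD)
    (M : set (fdist R (C * Z)%type)) (K : C * Z -> R)
    (hK : entropy_estimator D M K)
    (rho : fdist R (C * Z)%type) (hrho : M rho) :
  (expect rho (fun cz => (K cz)%:E) <= asymptotic_gain_rate D M rho)%E.
Proof.
apply/lee_addgt0Pr => e e_gt0.
set B := \sum_cz (2 * K cz ^+ 2 + 4).
have B_ge0 : 0 <= B.
  by apply: sumr_ge0 => cz _; have := sqr_ge0 (K cz); lra.
set k := \sum_cz `|K cz|.
have k_ge0 : 0 <= k by apply: sumr_ge0.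
have K_le cz : K cz <= k.
  apply: (le_trans (ler_norm _)).
  by rewrite /k (bigD1 cz) //= lerDl sumr_ge0.
(* The first bound yields [beta * (k + 1) <= 2^-1], the second keeps the loss [2 * B * beta] below
   [e]; the added 2 and 1 keep the denominators positive when [k] or [B] vanishes. *)
pose beta := Num.min (2 * k + 2)^-1 (e / (2 * B + 1)).
have beta_gt0 : 0 < beta.
  by rewrite lt_min invr_gt0 divr_gt0 ?andbT //; lra.
have betaK cz : beta * K cz <= 2^-1.
  apply: (@le_trans _ _ (beta * (k + 1))).
    by rewrite ler_pM2l //; have := K_le cz; lra.
  have : beta <= (2 * k + 2)^-1 by rewrite ge_min lexx.
  by rewrite -[leRHS]mul1r ler_pdivlMr; lra.
have betaB : 2 * B * beta <= e.
  have : beta <= e / (2 * B + 1) by rewrite ge_min lexx orbT.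
  by rewrite ler_pdivlMr; lra.
apply: (le_trans (log_prob_rate_estimator_PEF K beta_gt0 rho)).
apply: leeD; last by rewrite lee_fin.
apply: ereal_sup_ubound; exists beta, (estimator_PEF K beta).
by split=> //; apply: is_PEF_estimator_PEF.
Qed.
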